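(* Let $f:[0,\infty)\to[0,\infty)$ be a càdlàg function with non-negative jumps, $\Delta f(t)=f(t)-f(t-)\ge0$. Assume that $f=0$ on $\{0\}\cup[1,\infty)$ and $f>0$ on $(0,1)$. Let $(h^0,c^0)$ be the Lamperti pair associated to $f$. Then the solutions $c$ to $$c(0)=0,\qquad D_+c=f\circ c\quad\text{on }[0,\infty)\qquad( * )$$ are characterized as follows. 1. If $\int_{0+}\frac{1}{f(s)}ds=\infty$, then $h^0=c^0=0$ and $0$ is the unique solution to $( * )$. 2. If $\int_{0+}\frac1{f(s)}ds<\infty$, then $c^0$ is not identically zero and $D_+c^0=h^0$, so that $c^0$ solves $( * )$. Furthermore, the solutions to $( * )$ form the one-parameter family $(c^\lambda)_{\lambda\in[0,\infty]}$, where $$c^\lambda(t)=c^0([t-\lambda]^+)\ \text{ for }\lambda\in (0,\infty),\qquad c^\infty=0.$$ Finally, assume that $\int_{0+}\frac1{f(s)}ds<\infty$. (a) If $\int^{1-}\frac1{f(s)}ds=\infty$, then $c^0$ is strictly increasing on $[0,\infty)$, with $c^0(\infty)=\lim_{t\to\infty}c^0(t)=1$. (b) If $\int^{1-}\frac1{f(s)}ds<\infty$, then $c^0$ is strictly increasing until it reaches the value $1$, at the finite time $\int_0^1\frac1{f(s)}ds$.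
   Context: $D_+$ denotes the right-hand derivative; solutions are understood as continuous functions $c:[0,\infty)\to[0,\infty)$. $[x]^+=\max(x,0)$. Lamperti pair of $f$: $i(t)=\int_0^t\frac{1}{f(s)}ds$ (with $1/0=\infty$), $c^0(t)=\inf\{s\ge0:i(s)>t\}$ for $t\ge0$ (with $\inf\emptyset=1$), and $h^0=f\circ c^0$. $\int_{0+}1/f<\infty$ means $\int_0^\varepsilon 1/f(s)\,ds<\infty$ for some $\varepsilon\in (0,1)$ (otherwise the integral is said to be $\infty$); $\int^{1-}1/f<\infty$ means $\int_{1-\varepsilon}^1 1/f(s)\,ds<\infty$ for some $\varepsilon\in(0,1)$ (otherwise $\infty$).
   Formalization: The claims c^0(∞)=1 in (a) and that c^0 reaches 1 at the finite time ∫_0^1 1/f in (b) are proved assuming also ∫_a^b 1/f<∞ for all 0<a<b<1; without this they fail, as f may have left limit 0 at an interior jump. *)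

(* Defs.v *)
From HB Require Import structures.
From mathcomp Require Import all_boot all_order all_algebra.
From mathcomp Require Import all_classical all_reals all_analysis.

Set Implicit Arguments.
Unset Strict Implicit.
Unset Printing Implicit Defensive.

Import Order.TTheory GRing.Theory Num.Theory.
Import numFieldNormedType.Exports.

Local Open Scope classical_set_scope.
Local Open Scope ring_scope.

(* A function on [0, oo) is represented by a total function R -> R of which
   only the values on [0, oo) matter. *)

Section Defs.
Context {R : realType}.
Implicit Types (f c : R -> R) (t l a b : R).

Definition cadlag f :=
  (forall t, 0 <= t -> f x @[x --> t^'+] --> f t) /\
  (forall t, 0 < t -> cvg (f x @[x --> t^'-])).

Definition jump f t : R := f t - lim (f x @[x --> t^'-]).

Definition is_right_derive c t l :=
  (h^-1 * (c (t + h) - c t)) @[h --> 0^'+] --> l.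

(* The inverse is taken in \bar R, where 0^-1 = +oo. *)
Definition inv_integral f a b : \bar R :=
  (\int[lebesgue_measure]_(s in `[a, b]) ((f s)%:E)^-1)%E.

Definition lamperti_i f t : \bar R := inv_integral f 0 t.

Definition lamperti_c f t : R :=
  let A := [set s : R | 0 <= s /\ (t%:E < lamperti_i f s)%E] in
  if A == set0 then 1 else inf A.

Definition lamperti_h f : R -> R := f \o lamperti_c f.

Definition inv_integrable_at0 f :=
  exists e : R, [/\ 0 < e, e < 1 & (inv_integral f 0 e < +oo)%E].

Definition inv_integrable_at1 f :=
  exists e : R, [/\ 0 < e, e < 1 & (inv_integral f (1 - e) 1 < +oo)%E].

(* This holds as soon as the left limits of f are positive on (0, 1), for then
   f is bounded away from 0 on compact subsets of (0, 1). It is not automatic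
   when f is merely positive on (0, 1): f may have a zero left limit at some t
   in (0, 1), followed by a positive jump, and 1/f may then fail to be
   integrable to the left of t, so that lamperti_c f never exceeds t. *)
Definition inv_locally_integrable f :=
  forall a b, 0 < a -> a < b -> b < 1 -> (inv_integral f a b < +oo)%E.

Definition is_solution f c :=
  [/\ {within `[0, +oo[, continuous c},
      forall t, 0 <= t -> 0 <= c t,
      c 0 = 0 &
      forall t, 0 <= t -> is_right_derive c t (f (c t))].

(* Used for lambda in [0, +oo] only; for lambda = 0 it agrees with lamperti_c f
   on [0, oo). *)
Definition shifted_lamperti_c f (lambda : \bar R) t : R :=
  match lambda with
  | EFin l => lamperti_c f (Num.max (t - l) 0)
  | _ => 0
  end.

End Defs.

(* Main.v *)
(** Write [J x y] for the integral of 1/f over [x, y] and [i y = J 0 y].  By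
    right continuity of f, [J x y] is comparable to [(y - x) / f x] as y
    decreases to x, and i is continuous and strictly increasing where it is
    finite.  If i is finite at some x in (0, 1), it is also finite slightly to
    the right of x, so it can only become infinite by tending to infinity from
    the left or at the point 1.  Hence [i (c0 t) = t] as long as [c0 t < 1], and
    the right derivative of c0 follows from the comparison of J.

    Conversely, a solution c is nondecreasing and bounded by 1.  While
    0 < c < 1, the same comparison shows that [J (c s) (c t)] grows at unit
    rate in t, so [J (c s) (c t) = t - s].  Letting s decrease to the last zero a
    of c gives [i (c t) = t - a], that is [c t = c0 (t - a)]; this is absurd when
    1/f is not integrable at 0, and then c vanishes. *)

Require Import Defs.
From HB Require Import structures.
From mathcomp Require Import all_boot all_order all_algebra.
From mathcomp Require Import all_classical all_reals all_analysis.
From mathcomp Require Import measurable_realfun ring lra.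

Set Implicit Arguments.
Unset Strict Implicit.
Unset Printing Implicit Defensive.

Import Order.TTheory GRing.Theory Num.Theory.
Import numFieldNormedType.Exports.

Local Open Scope classical_set_scope.
Local Open Scope ring_scope.

(** * Epsilon-delta forms of limits and right derivatives, and real induction *)

Lemma within_continuousP {R : realType} (c : R -> R) :
  {within `[0, +oo[, continuous c} <-> forall t e : R, 0 <= t -> 0 < e ->
    exists2 d : R, 0 < d & forall s, 0 <= s -> `|s - t| < d -> `|c s - c t| < e.
Proof.
split=> [/subspace_continuousP H t e t0 e0|H].
  have t_in : [set` `[0, +oo[] t by rewrite /= in_itv/= t0.
  have /cvgrPdist_lt/(_ _ e0)[d /= d0 Hd] := H _ t_in; exists d => // s s0 st; rewrite distrC; apply: Hd => /=.
    by rewrite distrC.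
  by rewrite in_itv/= s0.
apply/subspace_continuousP => t; rewrite /= in_itv/= andbT => t0.
apply/cvgrPdist_lt => e e0; have [d d0 Hd] := H _ _ t0 e0.
exists d => //= s /=; rewrite distrC => st; rewrite in_itv/= andbT => s0.
by rewrite distrC; exact: Hd.
Qed.

Lemma near_at_rightP {R : realType} (P : R -> Prop) (t : R) :
  (\forall x \near t^'+, P x) <->
  exists2 d : R, 0 < d & forall x, t < x -> x < t + d -> P x.
Proof.
split=> [[d /= d0 H]|[d d0 H]]; exists d => //=.
  move=> x tx xd; apply: H => //=.
  by rewrite distrC gtr0_norm ?subr_gt0// ltrBlDl.
move=> x /= + tx; rewrite distrC gtr0_norm ?subr_gt0// ltrBlDl => xd.
exact: H.
Qed.

Lemma near_at_leftP {R : realType} (P : R -> Prop) (t : R) :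
  (\forall x \near t^'-, P x) <->
  exists2 d : R, 0 < d & forall x, t - d < x -> x < t -> P x.
Proof.
split=> [[d /= d0 H]|[d d0 H]]; exists d => //=.
  move=> x tx xd; apply: H => //=.
  by rewrite gtr0_norm ?subr_gt0//; lra.
move=> x /= + tx; rewrite gtr0_norm ?subr_gt0// => xd.
by apply: H => //; lra.
Qed.

Lemma is_right_deriveP {R : realType} (c : R -> R) (t l : R) :
  is_right_derive c t l <->
  forall e, 0 < e -> exists2 d, 0 < d & forall h, 0 < h -> h < d ->
    (l - e) * h <= c (t + h) - c t /\ c (t + h) - c t <= (l + e) * h.
Proof.
have E h e : 0 < h -> `|l - h^-1 * (c (t + h) - c t)| <= e <->
    (l - e) * h <= c (t + h) - c t /\ c (t + h) - c t <= (l + e) * h.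
  move=> h0; rewrite ler_distlC [_^-1 * _]mulrC ler_pdivlMr// ler_pdivrMr//.
  by split=> [/andP[]//|[-> ->]].
rewrite /is_right_derive; split=> [/cvgrPdist_le H e e0|H].
  have /near_at_rightP[d d0 {}H] := H _ e0; exists d => // h h0 hd.
  by apply/(E h e h0); apply: H => //; rewrite add0r.
apply/cvgrPdist_le => e e0; have [d d0 {}H] := H _ e0.
by apply/near_at_rightP; exists d => // h h0; rewrite add0r => hd; apply/E => //; apply: H.
Qed.

Lemma is_solution_ext {R : realType} (f c c' : R -> R) :
  (forall t : R, 0 <= t -> c t = c' t) -> is_solution f c' -> is_solution f c.
Proof.
move=> cE [/within_continuousP c_cont c_ge0 c0 c_der]; split.
- apply/within_continuousP => t e t0 e0; have [d d0 Hd] := c_cont _ _ t0 e0.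
  by exists d => // s s0; rewrite !cE//; exact: Hd.
- by move=> t t0; rewrite cE// c_ge0.
- by rewrite cE.
- move=> t t0; apply/is_right_deriveP => e e0.
  have [d d0 Hd] := (is_right_deriveP _ _ _).1 (c_der _ t0) _ e0.
  by exists d => // h h0 hd; rewrite !cE ?addr_ge0 ?(ltW h0)//; exact: Hd.
Qed.

(** The supremum of the points up to which [P] holds throughout inherits [P] by the left hypothesis,
    and the right one pushes past it unless it is [b]. This stands in for a mean value theorem, as
    only right derivatives are available. *)
Lemma real_induction {R : realType} (P : R -> Prop) (a b : R) : a <= b -> P a ->
  (forall t, a < t -> t <= b -> (forall s, a <= s -> s < t -> P s) -> P t) ->
  (forall t, a <= t -> t < b -> P t ->
    exists2 d, 0 < d & forall s, t < s -> s < t + d -> P s) ->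
  P b.
Proof.
move=> ab Pa Pleft Pright.
pose S := [set t | [/\ a <= t, t <= b & forall s, a <= s -> s <= t -> P s]].
have Sa : S a by split=> // s as_ sa; rewrite (_ : s = a)//; lra.
have bS : has_ubound S by exists b => t [].
have supS : has_sup S by split => //; exists a.
have a_le : a <= sup S by exact: ub_le_sup.
have le_b : sup S <= b by apply: ge_sup => [|t []//]; exists a.
have Plt s : a <= s -> s < sup S -> P s.
  move=> as_ sS; have [t [at_ tb Pt] st] := sup_adherent (ltac:(rewrite subr_gt0; exact: sS) : 0 < sup S - s) supS.
  by apply: Pt => //; lra.
have PS : P (sup S).
  move: a_le; rewrite le_eqVlt => /predU1P[<- //|aS].
  exact: Pleft.
move: le_b; rewrite le_eqVlt => /predU1P[<- //|Sb].
have [d d0 Pd] := Pright _ a_le Sb PS.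
pose u := Num.min b (sup S + d / 2).
have uS : sup S < u by rewrite lt_min Sb; lra.
have ud : u <= sup S + d / 2 by rewrite ge_min lexx orbT.
suff : S u by move=> /(ub_le_sup bS); lra.
split; [lra|by rewrite ge_min lexx|].
move=> s as_ su; have [sS|sS|->//] := ltgtP s (sup S); first exact: Plt.
by apply: Pd => //; lra.
Qed.

(** * The integral of 1/f *)

Section inv_integral_theory.
Context {R : realType} (f : R -> R).
Hypothesis f_ge0 : forall t : R, 0 <= t -> 0 <= f t.
Hypothesis f_cadlag : cadlag f.
Hypothesis f_jump : forall t : R, 0 < t -> 0 <= jump f t.
Implicit Types t a b x y z m M : R.

(* Since the jumps are non-negative, f is upper semicontinuous, so 1/f is lower
   semicontinuous and hence measurable. *)
Lemma near_lt_cadlag t a : 0 < t -> f t < a -> \forall x \near nbhs t, f x < a.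
Proof.
move=> t0 fta.
have [fr fl] := f_cadlag.
have fra : \forall x \near t^'+, f x < a by exact: cvgr_lt (fr _ (ltW t0)) _ fta.
have lta : lim (f x @[x --> t^'-]) < a.
  by have := f_jump t0; rewrite /jump; lra.
have fla : \forall x \near t^'-, f x < a by exact: cvgr_lt (fl _ t0) _ lta.
have [d d0 Hd] := (near_at_rightP _ _).1 fra.
have [d' d'0 Hd'] := (near_at_leftP _ _).1 fla.
exists (Num.min d d') => /=; first by rewrite lt_min d0.
move=> x /=; rewrite lt_min !ltr_distlC => /andP[/andP[x1 x2] /andP[x3 x4]].
have [xt|xt|->//] := ltgtP x t.
  by apply: Hd' => //; lra.
by apply: Hd.
Qed.

Lemma lt_inve_EFin (a y : R) : 0 <= y -> (a%:E < y%:E^-1)%E = (a * y < 1).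
Proof.
rewrite inver le_eqVlt => /predU1P[<-|y0].
  by rewrite eqxx mulr0 ltr01 ltry.
by rewrite gt_eqF// lte_fin -ltr_pdivlMr// mul1r.
Qed.

Lemma measurable_fun_inv (D : set R) : measurable D -> D `<=` `[0, +oo[ ->
  measurable_fun D (fun s => ((f s)%:E)^-1)%E.
Proof.
move=> mD D0.
suff : measurable_fun (`[0, +oo[ : set R) (fun s => ((f s)%:E)^-1)%E.
  exact: measurable_funS.
apply/emeasurable_fun_itv_obnd_cbndP.
(* Nothing is known of [f] on negative reals. The value 0 there and at 0 keeps the nonnegative
   function [G] lower semicontinuous on the whole line. *)
pose G x : \bar R := if 0 < x then (((f x)%:E)^-1)%E else 0%E.
apply: (eq_measurable_fun G).
  by move=> x; rewrite inE/= in_itv/= andbT /G => ->.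
apply: (measurable_funS measurableT) => //.
have G0 x : (0 <= G x)%E.
  by rewrite /G; case: ifPn => // /ltW /f_ge0 fx; rewrite inve_ge0.
apply: lower_semicontinuous_measurable => x a.
have [a0 _|a0] := ltP a 0.
  by exists setT; [exact: filterT|move=> y _; exact: lt_le_trans (G0 y)].
rewrite {1}/G; case: ifPn => x0; last by rewrite lte_fin ltNge a0.
rewrite lt_inve_EFin ?f_ge0 ?ltW// => afx.
have near0 : \forall y \near nbhs x, 0 < y.
  by exists x => //= y /=; rewrite ltr_distlC => /andP[+ _]; lra.
have neara : \forall y \near nbhs x, a * f y < 1.
  move: a0; rewrite le_eqVlt => /predU1P[<-|a0].
    by apply: nearW => y; rewrite mul0r.
  have fxa : f x < a^-1 by rewrite -[a^-1]mul1r ltr_pdivlMr// mulrC.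
  near=> y; rewrite mulrC -ltr_pdivlMr// mul1r; near: y.
  exact: near_lt_cadlag.
exists [set y | 0 < y /\ a * f y < 1].
  by near=> y; split; near: y.
by move=> y /= [y0 ?]; rewrite /G y0 lt_inve_EFin// f_ge0 ?ltW.
Unshelve. all: by end_near. Qed.

Lemma inv_integral_ge0 x y : 0 <= x -> (0 <= inv_integral f x y)%E.
Proof.
move=> x0; apply: integral_ge0 => s /=; rewrite in_itv/= => /andP[xs _].
by rewrite inve_ge0 lee_fin f_ge0// (le_trans x0).
Qed.

Lemma inv_integral_xx x : inv_integral f x x = 0%E.
Proof. by rewrite /inv_integral set_itv1 integral_set1. Qed.

Lemma subset_itv_nonneg (x y : R) (b : bool) : 0 <= x ->
  [set` Interval (BSide b x) (BRight y)] `<=` (`[0, +oo[ : set R).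
Proof.
move=> x0 s /=; rewrite !in_itv/= andbT => /andP[+ _].
by case: b => /=; [exact: le_trans|move=> /ltW; exact: le_trans].
Qed.

Lemma inv_integral_add x y z : 0 <= x -> x <= y -> y <= z ->
  inv_integral f x z = (inv_integral f x y + inv_integral f y z)%E.
Proof.
move=> x0 xy yz; rewrite {1 2}/inv_integral.
rewrite (@itv_bndbnd_setU _ _ _ (BRight y)) ?bnd_simp//.
rewrite ge0_integral_setU//=; last 3 first.
- apply: measurable_fun_inv; first exact: measurableU.
  rewrite subUset; split; first exact: subset_itv_nonneg.
  by apply: subset_itv_nonneg; lra.
- move=> s sxz; rewrite inve_ge0 lee_fin f_ge0//.
  by case: sxz => /=; rewrite in_itv/= => /andP[? ?]; lra.
- rewrite disj_set2E; apply/eqP; rewrite -subset0 => s [] /=.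
  by rewrite !in_itv/= => /andP[? ?] /andP[? ?]; lra.
congr (_ + _)%E; rewrite /inv_integral integral_itv_obnd_cbnd//.
by apply: measurable_fun_inv => //; apply: subset_itv_nonneg; lra.
Qed.

Lemma inv_integral_itvoo x y : 0 <= x -> inv_integral f x y =
  (\int[lebesgue_measure]_(s in `]x, y[) ((f s)%:E)^-1)%E.
Proof.
move=> x0; rewrite /inv_integral integral_itv_bndoo//.
apply: measurable_fun_inv => // s /=; rewrite !in_itv/= => /andP[? ?]; lra.
Qed.

Lemma integral_cst_itvoo (x y m : R) : x <= y ->
  (\int[lebesgue_measure]_(s in `]x, y[) m%:E = (m * (y - x))%:E)%E.
Proof.
move=> xy; rewrite integral_cst//= lebesgue_measure_itv/= lte_fin.
case: ltP => [_|yx]; first by rewrite -EFinD -EFinM.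
by rewrite mule0 (_ : y - x = 0) ?mulr0//; lra.
Qed.

(** The bound is written as a product so that it also covers [m = 0] and zeros of [f], where the
    integrand is [+oo]. *)
Lemma le_inv_integral x y m : 0 <= x -> x <= y -> 0 <= m ->
  (forall s, x < s -> s < y -> m * f s <= 1) ->
  ((m * (y - x))%:E <= inv_integral f x y)%E.
Proof.
move=> x0 xy m0 H; rewrite inv_integral_itvoo// -integral_cst_itvoo//.
apply: ge0_le_integral => //.
- apply: measurable_fun_inv => // s /=; rewrite !in_itv/= => /andP[? ?]; lra.
- move=> s /=; rewrite in_itv/= => /andP[xs sy]; have := H _ xs sy.
  have /f_ge0 : 0 <= s by lra.
  rewrite inver le_eqVlt => /predU1P[<-|y0]; first by rewrite eqxx leey.
  by rewrite gt_eqF// lee_fin -ler_pdivlMr// mul1r.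
Qed.

Lemma inv_integral_le x y M : 0 <= x -> x <= y ->
  (forall s, x < s -> s < y -> 1 <= M * f s /\ 0 < f s) ->
  (inv_integral f x y <= (M * (y - x))%:E)%E.
Proof.
move=> x0 xy H; rewrite inv_integral_itvoo// -integral_cst_itvoo//.
apply: ge0_le_integral => //.
- move=> s /=; rewrite in_itv/= => /andP[xs sy].
  by rewrite inve_ge0 lee_fin f_ge0//; lra.
- apply: measurable_fun_inv => // s /=; rewrite !in_itv/= => /andP[? ?]; lra.
- move=> s /=; rewrite in_itv/= => /andP[xs sy].
  have [M1 fs0] := H _ xs sy.
  by rewrite inver gt_eqF// lee_fin -[_^-1]mul1r ler_pdivrMr.
Qed.

(** Monotone convergence along the intervals [[x, y - 1/(n+1)]]. This is left continuity of the
    integral in its upper end, valid even for infinite values. *)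
Lemma inv_integral_le_left x y B : 0 <= x -> x < y ->
  (forall z, x <= z -> z < y -> (inv_integral f x z <= B)%E) ->
  (inv_integral f x y <= B)%E.
Proof.
move=> x0 xy H.
(* Needed for small n, when the approximating interval is empty. *)
have B0 : (0 <= B)%E by rewrite -(inv_integral_xx x); exact: H.
rewrite /inv_integral -integral_itv_bndo_bndc; last first.
  apply: measurable_fun_inv => // s /=; rewrite !in_itv/= => /andP[? ?]; lra.
rewrite itv_bnd_open_bigcup.
have : (\int[lebesgue_measure]_(s in `[x, (y - n.+1%:R^-1)%R]) ((f s)%:E)^-1 @[n --> \oo] -->
   \int[lebesgue_measure]_(s in \bigcup_n `[x, (y - n.+1%:R^-1)%R]%classic) ((f s)%:E)^-1)%E.
  apply: ge0_nondecreasing_set_cvg_integral => //.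
  - move=> m n mn; apply/subsetPset => s /=; rewrite !in_itv/= => /andP[-> sm]/=.
    by rewrite (le_trans sm)// lerB// lef_pV2 ?posrE// ler_nat.
  - by move=> n; apply: measurable_fun_inv => //; exact: subset_itv_nonneg.
  - move=> n s /=; rewrite in_itv/= => /andP[xs _].
    by rewrite inve_ge0 lee_fin f_ge0//; lra.
move=> cvgF; apply: (cvge_to_le cvgF); apply: nearW => n.
have [xn|xn] := leP x (y - n.+1%:R^-1).
  by apply: H => //; rewrite ltrBlDr ltrDl.
by rewrite set_itv_ge ?integral_set0// bnd_simp -ltNge.
Qed.

Lemma inv_integral_le_right x y B : 0 <= x -> x < y ->
  (forall z, x < z -> z <= y -> (inv_integral f z y <= B)%E) ->
  (inv_integral f x y <= B)%E.
Proof.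
move=> x0 xy H.
have B0 : (0 <= B)%E by rewrite -(inv_integral_xx y); exact: H.
rewrite /inv_integral -integral_itv_obnd_cbnd; last first.
  by apply: measurable_fun_inv => //; exact: subset_itv_nonneg.
rewrite itv_open_bnd_bigcup.
have x0' n : 0 <= x + n.+1%:R^-1 by rewrite addr_ge0.
have : (\int[lebesgue_measure]_(s in `[(x + n.+1%:R^-1)%R, y]) ((f s)%:E)^-1 @[n --> \oo] -->
   \int[lebesgue_measure]_(s in \bigcup_n `[(x + n.+1%:R^-1)%R, y]%classic) ((f s)%:E)^-1)%E.
  apply: ge0_nondecreasing_set_cvg_integral => //.
  - move=> m n mn; apply/subsetPset => s /=; rewrite !in_itv/= => /andP[+ ->].
    by rewrite andbT; apply: le_trans; rewrite lerD2l lef_pV2 ?posrE// ler_nat.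
  - by move=> n; apply: measurable_fun_inv => //; exact: subset_itv_nonneg.
  - move=> n s /=; rewrite in_itv/= => /andP[xs _].
    by rewrite inve_ge0 lee_fin f_ge0// (le_trans _ xs).
move=> cvgF; apply: (cvge_to_le cvgF); apply: nearW => n.
have [xn|xn] := leP (x + n.+1%:R^-1) y.
  by apply: H => //; rewrite ltrDl.
by rewrite set_itv_ge ?integral_set0// bnd_simp -ltNge.
Qed.

(** Right continuity keeps [f] between [f t - e] and [f t + e] just after [t]. Only the upper bound
    on the integral requires [f t - e] to be positive. *)
Lemma inv_integral_right_bounds t e : 0 <= t -> 0 < e ->
  exists2 d, 0 < d & forall x, t < x -> x < t + d ->
    (((x - t) / (f t + e))%:E <= inv_integral f t x)%E /\
    (e < f t -> (inv_integral f t x <= ((x - t) / (f t - e))%:E)%E).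
Proof.
move=> t0 e0; have [fr _] := f_cadlag.
have lt_fe : \forall x \near t^'+, f x < f t + e.
  by apply: cvgr_lt (fr _ t0) _ _; lra.
have gt_fe : \forall x \near t^'+, f t - e < f x.
  by apply: cvgr_gt (fr _ t0) _ _; lra.
have [d d0 Hd] := (near_at_rightP _ _).1 lt_fe.
have [d' d'0 Hd'] := (near_at_rightP _ _).1 gt_fe.
exists (Num.min d d'); first by rewrite lt_min d0.
move=> x tx; rewrite -ltrBlDl lt_min => /andP[xd xd'].
have ft0 := f_ge0 t0.
split=> [|eft]; rewrite mulrC.
  apply: le_inv_integral => //; first exact: ltW.
    by rewrite invr_ge0; lra.
  move=> s ts sx; rewrite mulrC ler_pdivrMr ?mul1r; last lra.
  by apply/ltW/Hd => //; lra.
apply: inv_integral_le => //; first exact: ltW.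
move=> s ts sx; rewrite mulrC ler_pdivlMr ?mul1r; last lra.
have : f t - e < f s by apply: Hd' => //; lra.
by split; lra.
Qed.

Lemma le_inv_integral_left x y z : 0 <= x -> x <= y ->
  (inv_integral f y z <= inv_integral f x z)%E.
Proof.
move=> x0 xy; apply: ge0_subset_integral => //.
- by apply: measurable_fun_inv => //; exact: subset_itv_nonneg.
- move=> s /=; rewrite in_itv/= => /andP[xs _].
  by rewrite inve_ge0 lee_fin f_ge0//; lra.
- by move=> s /=; rewrite !in_itv/= => /andP[ys ->]; rewrite andbT; lra.
Qed.

Lemma le_inv_integral_right x y z : 0 <= x -> y <= z ->
  (inv_integral f x y <= inv_integral f x z)%E.
Proof.
move=> x0 yz; apply: ge0_subset_integral => //.
- by apply: measurable_fun_inv => //; exact: subset_itv_nonneg.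
- move=> s /=; rewrite in_itv/= => /andP[xs _].
  by rewrite inve_ge0 lee_fin f_ge0//; lra.
- by move=> s /=; rewrite !in_itv/= => /andP[-> ?] /=; lra.
Qed.

Lemma inv_integral_gt0 x y : 0 <= x -> x < y -> (0 < inv_integral f x y)%E.
Proof.
move=> x0 xy; have [d d0 H] := inv_integral_right_bounds x0 ltr01.
pose z := Num.min y (x + d / 2).
have xz : x < z by rewrite lt_min xy; lra.
have zd : z < x + d by rewrite gt_min; apply/orP; right; lra.
have [+ _] := H _ xz zd.
have zy : z <= y by rewrite ge_min lexx.
move=> le_z; apply: lt_le_trans (le_inv_integral_right x0 zy).
apply: lt_le_trans le_z; rewrite lte_fin divr_gt0 ?subr_gt0//.
by have := f_ge0 x0; lra.
Qed.

Lemma inv_integral_lt x y : 0 <= x -> x < y ->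
  (inv_integral f 0 x < +oo)%E -> (inv_integral f 0 x < inv_integral f 0 y)%E.
Proof.
move=> x0 xy fin; rewrite (@inv_integral_add 0 x y)//; last exact: ltW.
rewrite lteDl ?inv_integral_gt0//.
by rewrite ge0_fin_numE// inv_integral_ge0.
Qed.

(** Otherwise J z y is at most i y - r for every z in (x, y]. Letting z decrease to x gives the same
    bound for J x y, hence r is at most i x. Finiteness at [y] makes the subtractions legitimate. *)
Lemma inv_integral_right_continuous x y (r : \bar R) : 0 <= x -> x < y ->
  (inv_integral f 0 y < +oo)%E -> (inv_integral f 0 x < r)%E ->
  exists z, [/\ x < z, z <= y & (inv_integral f 0 z < r)%E].
Proof.
move=> x0 xy fin ixr; apply: contrapT => H.
have ge_r z : x < z -> z <= y -> (r <= inv_integral f 0 z)%E.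
  by move=> xz zy; rewrite leNgt; apply/negP => ?; apply: H; exists z.
have finz z : z <= y -> inv_integral f 0 z \is a fin_num.
  move=> zy; rewrite ge0_fin_numE ?inv_integral_ge0//.
  exact: le_lt_trans (le_inv_integral_right (lexx 0) zy) fin.
have r_fin : r \is a fin_num.
  rewrite fin_real// (lt_le_trans _ (ltW ixr))/=; last first.
    by rewrite (lt_le_trans _ (inv_integral_ge0 _ _)).
  by apply: le_lt_trans fin; exact: ge_r.
have : (inv_integral f x y <= inv_integral f 0 y - r)%E.
  apply: inv_integral_le_right => // z xz zy.
  rewrite (@inv_integral_add 0 z y)//; last lra.
  rewrite leeBrDr// addeC leeD2r//; exact: ge_r.
rewrite leNgt => /negP; apply.
rewrite lteBlDr// (@inv_integral_add 0 x y)//; last exact: ltW.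
rewrite addeC lteD2lE//.
have := finz y (lexx _); rewrite (@inv_integral_add 0 x y)//; last exact: ltW.
by rewrite fin_numD => /andP[].
Qed.

(** * The Lamperti inverse *)

Hypothesis f_after1 : forall t : R, 1 <= t -> f t = 0.

Lemma inv_integral_after1 x : 1 < x -> inv_integral f 0 x = +oo%E.
Proof.
move=> x1; apply/eqyP => m m0.
apply: le_trans (le_inv_integral_left x (lexx 0) ler01).
(* The integrand is infinite on [1, x], so it dominates the constant [m / (x - 1)], whose integral
   there is [m]. *)
have -> : m = m / (x - 1) * (x - 1) by rewrite divfK// subr_eq0 gt_eqF.
apply: le_inv_integral => //; first exact: ltW.
  by rewrite divr_ge0//; lra.
by move=> s s1 _; rewrite f_after1 ?mulr0//; lra.
Qed.

(** The set always contains 2, so the default value 1 is never taken. *)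
Lemma lamperti_cE t : lamperti_c f t =
  inf [set s : R | 0 <= s /\ (t%:E < inv_integral f 0 s)%E].
Proof.
rewrite /lamperti_c; case: eqP => // A0; exfalso.
suff : (set0 : set R) 2 by [].
by rewrite -A0 /= /lamperti_i inv_integral_after1 ?ltry//; lra.
Qed.

(** With [lamperti_c_gt] and [lamperti_c_ge], this transfers inequalities between c0 and i without
    returning to the infimum. *)
Lemma lamperti_c_le t s : 0 <= s -> (t%:E < inv_integral f 0 s)%E ->
  lamperti_c f t <= s.
Proof.
move=> s0 ts; rewrite lamperti_cE; apply: ge_inf => //=.
by exists 0 => x [].
Qed.

Lemma lamperti_c_gt t s : lamperti_c f t < s -> (t%:E < inv_integral f 0 s)%E.
Proof.
rewrite lamperti_cE => ts.
have /inf_adherent : has_inf [set s : R | 0 <= s /\ (t%:E < inv_integral f 0 s)%E].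
  split; last by exists 0 => x [].
  by exists 2 => /=; rewrite inv_integral_after1 ?ltry//; lra.
have e0 : 0 < s - inf [set s : R | 0 <= s /\ (t%:E < inv_integral f 0 s)%E].
  by rewrite subr_gt0.
move=> /(_ _ e0)[x [x0 tx]]; rewrite subrKC => xs.
by apply: lt_le_trans tx _; apply: le_inv_integral_right => //; exact: ltW.
Qed.

Lemma lamperti_c_ge t s : (inv_integral f 0 s <= t%:E)%E -> s <= lamperti_c f t.
Proof. by apply: contraTT; rewrite -!ltNge; exact: lamperti_c_gt. Qed.

Lemma lamperti_c_le1 t : lamperti_c f t <= 1.
Proof.
apply/ler_addgt0Pr => e e0; apply: lamperti_c_le; first lra.
by rewrite inv_integral_after1 ?ltry//; lra.
Qed.

Lemma lamperti_c_ge0 t : 0 <= lamperti_c f t.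
Proof.
rewrite lamperti_cE; apply: lb_le_inf; last by move=> s [].
by exists 2 => /=; rewrite inv_integral_after1 ?ltry//; lra.
Qed.

Lemma lamperti_c_nondecreasing s t : s <= t -> lamperti_c f s <= lamperti_c f t.
Proof.
move=> st; apply/ler_addgt0Pr => e e0; apply: lamperti_c_le.
  by have := lamperti_c_ge0 t; lra.
apply: (@le_lt_trans _ _ t%:E); first by rewrite lee_fin.
by apply: lamperti_c_gt; lra.
Qed.

Lemma lamperti_c0 : lamperti_c f 0 = 0.
Proof.
apply/eqP; rewrite eq_le lamperti_c_ge0 andbT.
apply/ler_addgt0Pr => e e0; rewrite add0r; apply: lamperti_c_le; first exact: ltW.
exact: inv_integral_gt0.
Qed.

(** Every z below c0 t has i z at most t, and left continuity of i extends this to c0 t itself. *)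
Lemma inv_integral_lamperti_c_le t : 0 <= t ->
  (inv_integral f 0 (lamperti_c f t) <= t%:E)%E.
Proof.
move=> t0; have := lamperti_c_ge0 t; rewrite le_eqVlt => /predU1P[<-|c0].
  by rewrite inv_integral_xx.
apply: inv_integral_le_left => // z z0 zc; rewrite leNgt; apply/negP => tz.
by have := lamperti_c_le z0 tz; lra.
Qed.

(** * The equation satisfied by the Lamperti inverse *)

Hypothesis f_pos : forall t : R, 0 < t -> t < 1 -> 0 < f t.

Lemma inv_integral_extend x : 0 < x -> x < 1 -> (inv_integral f 0 x < +oo)%E ->
  exists2 y, x < y & (inv_integral f 0 y < +oo)%E.
Proof.
move=> x0 x1 fin; have fx := f_pos x0 x1.
have fx2 : 0 < f x / 2 by lra.
have [d d0 H] := inv_integral_right_bounds (ltW x0) fx2.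
have [||_] := H (x + d / 2); [lra|lra|].
have h : f x / 2 < f x by lra.
move=> /(_ h) le_J; exists (x + d / 2); first lra.
rewrite (@inv_integral_add 0 x)//; [|lra|lra].
by rewrite lte_add_pinfty// (le_lt_trans le_J)// ltry.
Qed.

Hypothesis int0 : inv_integrable_at0 f.

(** If i (c0 t) < t, then i is still below t at some z > c0 t by right continuity, against the
    definition of c0. The finiteness of i beyond c0 t comes from [int0] when c0 t = 0 and from
    [inv_integral_extend] otherwise. *)
Lemma inv_integral_lamperti_c t : 0 <= t -> lamperti_c f t < 1 ->
  inv_integral f 0 (lamperti_c f t) = t%:E.
Proof.
move=> t0 c1; apply/eqP; rewrite eq_le inv_integral_lamperti_c_le//=.
rewrite leNgt; apply/negP => ct.
have c0 := lamperti_c_ge0 t.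
have [y cy finy] : exists2 y, lamperti_c f t < y & (inv_integral f 0 y < +oo)%E.
  have [<-|cne0] := eqVneq 0 (lamperti_c f t).
    by have [e [? ? ?]] := int0; exists e.
  by apply: inv_integral_extend => //; [rewrite lt_neqAle cne0|exact: lt_trans (ltry t)].
have [z [cz _]] := inv_integral_right_continuous c0 cy finy ct.
by move=> /ltW/lamperti_c_ge; lra.
Qed.

Lemma lamperti_c_lt s t : 0 <= s -> s < t -> lamperti_c f s < 1 ->
  lamperti_c f s < lamperti_c f t.
Proof.
move=> s0 st c1; rewrite lt_neqAle lamperti_c_nondecreasing ?(ltW st)// andbT.
apply/eqP => E; have := inv_integral_lamperti_c s0 c1.
rewrite E inv_integral_lamperti_c ?(le_trans s0 (ltW st)) -?E// => -[]; lra.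
Qed.

Lemma lamperti_c_neq0 : exists t, 0 <= t /\ lamperti_c f t <> 0.
Proof.
have [e [e0 _ fin]] := int0.
have fin_e : inv_integral f 0 e \is a fin_num.
  by rewrite ge0_fin_numE// inv_integral_ge0.
exists (fine (inv_integral f 0 e)); split.
  by rewrite fine_ge0// inv_integral_ge0.
suff : e <= lamperti_c f (fine (inv_integral f 0 e)) by lra.
by apply: lamperti_c_ge; rewrite fineK.
Qed.

(** Since i z exceeds t, c0 stays below z up to time i z; if i z is infinite, any [d] works. *)
Lemma lamperti_c_right_continuous t z : lamperti_c f t < z ->
  exists2 d, 0 < d & forall s, s < t + d -> lamperti_c f s <= z.
Proof.
move=> cz; have z0 : 0 <= z by have := lamperti_c_ge0 t; lra.
have := lamperti_c_gt cz; case E : (inv_integral f 0 z) => [r| |]//; last first.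
  move=> _; exists 1 => // s _; apply: lamperti_c_le => //.
  by rewrite E ltry.
rewrite lte_fin => tr; exists (r - t); first lra.
by move=> s st; apply: lamperti_c_le => //; rewrite E lte_fin; lra.
Qed.

(** Strict increase of i gives i z < i (c0 t) <= t, and c0 is at least z from time i z on. *)
Lemma lamperti_c_left_continuous t z : 0 <= t -> z < lamperti_c f t ->
  exists2 d, 0 < d & forall s, t - d < s -> z <= lamperti_c f s.
Proof.
move=> t0 zc; have [z0|z0] := leP z 0.
  by exists 1 => // s _; have := lamperti_c_ge0 s; lra.
have [+ +] := (inv_integral_lt (ltW z0) zc, inv_integral_lamperti_c_le t0).
have := inv_integral_ge0 z (lexx 0).
case E : (inv_integral f 0 z) => [r| |]// _; last first.
  by move=> _ H; have := le_trans (le_inv_integral_right (lexx 0) (ltW zc)) H; rewrite E.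
move=> /(_ (ltry r)) H1 H2; have := lt_le_trans H1 H2; rewrite lte_fin => rt.
by exists (t - r); [lra|move=> s st; apply: lamperti_c_ge; rewrite E lee_fin; lra].
Qed.

Lemma is_right_derive_lamperti_c t : 0 <= t ->
  is_right_derive (lamperti_c f) t (f (lamperti_c f t)).
Proof.
move=> t0; apply/is_right_deriveP => e e0.
have c0 := lamperti_c_ge0 t.
(* Once c0 is at 1 it stays there, in accordance with f 1 = 0. *)
have := lamperti_c_le1 t; rewrite le_eqVlt => /predU1P[E|c1].
  exists 1 => // h h0 _; rewrite E f_after1// sub0r add0r.
  have := @lamperti_c_nondecreasing t (t + h); have := lamperti_c_le1 (t + h).
  by rewrite E; nra.
have [d d0 Hd] := inv_integral_right_bounds c0 e0.
(* The first bound keeps c0 (t + h) below 1, so that i still inverts c0 there; the second keeps it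
   within the range of [Hd]. *)
have zgt : lamperti_c f t < Num.min ((lamperti_c f t + 1) / 2) (lamperti_c f t + d / 2).
  by rewrite lt_min; apply/andP; split; lra.
have [d' d'0 Hd'] := lamperti_c_right_continuous zgt.
exists d' => // h h0 hd.
have := Hd' (t + h); rewrite ltrD2l => /(_ hd); rewrite le_min => /andP[c'1 c'd].
have cc' : lamperti_c f t < lamperti_c f (t + h) by apply: lamperti_c_lt => //; lra.
have Jh : inv_integral f (lamperti_c f t) (lamperti_c f (t + h)) = h%:E.
  have : inv_integral f 0 (lamperti_c f (t + h)) = (t + h)%:E.
    by apply: inv_integral_lamperti_c; lra.
  rewrite (@inv_integral_add 0 (lamperti_c f t))//; last exact: ltW.
  rewrite inv_integral_lamperti_c// EFinD.
  by move=> /(congr1 (fun x : \bar R => x - t%:E)%E); rewrite !(addeC t%:E) !addeK.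
have [|] := Hd _ cc'; first lra.
have fc := f_ge0 c0.
rewrite Jh !lee_fin ler_pdivrMr; last lra.
move=> le1 le2; split; last lra.
(* When [f (lamperti_c f t) <= e], the required lower bound is nonpositive and monotonicity
   suffices. *)
have [efc|fce] := ltP e (f (lamperti_c f t)); last by nra.
by move: (le2 efc); rewrite ler_pdivlMr; lra.
Qed.

Lemma lamperti_c_solution : is_solution f (lamperti_c f).
Proof.
split.
- apply/within_continuousP => t e t0 e0.
  have le : lamperti_c f t < lamperti_c f t + e / 2 by lra.
  have [d d0 Hd] := lamperti_c_right_continuous le.
  have ge : lamperti_c f t - e / 2 < lamperti_c f t by lra.
  have [d' d'0 Hd'] := lamperti_c_left_continuous t0 ge.
  have mind : Num.min d d' <= d by rewrite ge_min lexx.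
  have mind' : Num.min d d' <= d' by rewrite ge_min lexx orbT.
  exists (Num.min d d'); first by rewrite lt_min d0.
  move=> s s0; rewrite !ltr_distl => /andP[ts st].
  have cs : lamperti_c f s <= lamperti_c f t + e / 2 by apply: Hd; lra.
  have cs' : lamperti_c f t - e / 2 <= lamperti_c f s by apply: Hd'; lra.
  by apply/andP; split; lra.
- by move=> t _; exact: lamperti_c_ge0.
- exact: lamperti_c0.
- exact: is_right_derive_lamperti_c.
Qed.

(** * The zero solution and delayed solutions *)

Lemma zero_solution : f 0 = 0 -> is_solution f (fun=> 0).
Proof.
move=> f_at0; split => //.
  by apply/within_continuousP => t e _ e0; exists 1 => // s _ _; rewrite subrr normr0.
move=> t _; apply/is_right_deriveP => e e0; exists 1 => // h h0 _.
by rewrite f_at0 subrr; nra.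
Qed.

(** Up to time [l] the solution waits at 0, where f vanishes; from [l] on it is a translate of [c].
    At [l] itself only the right derivative of [c] at 0 is involved. *)
Lemma shifted_solution c l : f 0 = 0 -> 0 <= l -> is_solution f c ->
  is_solution f (fun t => c (Num.max (t - l) 0)).
Proof.
move=> f_at0 l0 [/within_continuousP c_cont c_ge0 c0 c_der].
have max_lt t : t < l -> Num.max (t - l) 0 = 0 by move=> tl; apply/max_idPr; lra.
have max_ge t : l <= t -> Num.max (t - l) 0 = t - l by move=> tl; apply/max_idPl; lra.
have max_ge0 t : 0 <= Num.max (t - l) 0 by rewrite le_max lexx orbT.
split.
- apply/within_continuousP => t e t0 e0.
  have [d d0 Hd] := c_cont _ _ (max_ge0 t) e0.
  exists d => // s s0 st; apply: Hd => //.
  (* Truncated translation is 1-Lipschitz, so the same [d] serves. *)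
  apply: le_lt_trans st; rewrite ler_distlC.
  have := ler_norm (s - t); have := ler_norm (t - s); rewrite (distrC t s).
  by case: (leP (s - l) 0); case: (leP (t - l) 0) => *; apply/andP; split; lra.
- by move=> t t0; exact: c_ge0.
- by rewrite (_ : Num.max (0 - l) 0 = 0)//; apply/max_idPr; lra.
- move=> t t0; apply/is_right_deriveP => e e0; have [tl|tl] := ltP t l.
    exists (l - t); first lra.
    move=> h h0 hl; rewrite !max_lt ?c0; [|lra|lra].
    by rewrite f_at0 subrr; nra.
  have tl0 : 0 <= t - l by lra.
  have [d d0 Hd] := (is_right_deriveP _ _ _).1 (c_der _ tl0) _ e0.
  exists d => // h h0 hd; rewrite !max_ge; [|lra|lra].
  by rewrite (_ : t + h - l = t - l + h); [exact: Hd|lra].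
Qed.

(** * Arbitrary solutions *)

Section solution.
Variable c : R -> R.
Hypothesis c_sol : is_solution f c.

Let c_cont t e : 0 <= t -> 0 < e ->
  exists2 d, 0 < d & forall s, 0 <= s -> `|s - t| < d -> `|c s - c t| < e.
Proof. by have [/within_continuousP + _ _ _] := c_sol; exact. Qed.

Let c_ge0 t : 0 <= t -> 0 <= c t.
Proof. by have [_ + _ _] := c_sol; exact. Qed.

Let c_at0 : c 0 = 0.
Proof. by have [] := c_sol. Qed.

Let c_der t e : 0 <= t -> 0 < e -> exists2 d, 0 < d & forall h, 0 < h -> h < d ->
    (f (c t) - e) * h <= c (t + h) - c t /\ c (t + h) - c t <= (f (c t) + e) * h.
Proof.
have [_ _ _ H] := c_sol.
by move=> t0 e0; exact: (is_right_deriveP _ _ _).1 (H _ t0) _ e0.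
Qed.

Lemma solution_left_lt t z : 0 < t -> z < c t ->
  exists2 d, 0 < d & forall s, 0 <= s -> t - d < s -> s < t -> z < c s.
Proof.
move=> t0 zc; have zc0 : 0 < c t - z by lra.
have [d d0 Hd] := c_cont (ltW t0) zc0; exists d => // s s0 s1 s2.
have : `|c s - c t| < c t - z by apply: Hd => //; rewrite ltr_distlC; apply/andP; split; lra.
by rewrite ltr_distlC => /andP[]; lra.
Qed.

(** Right derivatives are nonnegative, so real induction shows that [c] loses at most [eps] per unit
    of time, for every [eps > 0]. *)
Lemma solution_nondecreasing s t : 0 <= s -> s <= t -> c s <= c t.
Proof.
move=> s0 st; apply/ler_addgt0Pr => e e0.
have ts0 : 0 < t - s + 1 by lra.
(* The added 1 keeps the denominator positive when [s = t]. *)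
pose eps := e / (t - s + 1).
have eps0 : 0 < eps by exact: divr_gt0.
suff : c s <= c t + eps * (t - s).
  have : eps * (t - s + 1) = e by rewrite /eps divfK// gt_eqF.
  by nra.
apply: (@real_induction _ (fun u => c s <= c u + eps * (u - s)) s t) => //.
- by rewrite subrr mulr0 addr0.
- move=> u su ut IH; rewrite leNgt; apply/negP => lt_cs.
  have u0 : 0 <= u by lra.
  pose g := c s - (c u + eps * (u - s)).
  have g0 : 0 < g by rewrite subr_gt0.
  have [d d0 Hd] := c_cont u0 g0.
  pose r := Num.max s (u - d / 2).
  have sr : s <= r by rewrite le_max lexx.
  have ru : r < u by rewrite gt_max su; lra.
  have dr : u - d / 2 <= r by rewrite le_max lexx orbT.
  have : `|c r - c u| < g.
    by apply: Hd; [lra|rewrite ltr_distlC; apply/andP; split; lra].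
  rewrite ltr_distlC => /andP[+ _]; have := IH r sr ru.
  have : eps * (r - s) <= eps * (u - s) by rewrite ler_pM2l//; lra.
  by rewrite /g; lra.
- move=> u su ut IH; have u0 : 0 <= u by lra.
  have [d d0 Hd] := c_der u0 eps0; exists d => // v uv vd.
  have [||+ _] := Hd (v - u); [lra|lra|].
  rewrite subrKC; have := f_ge0 (c_ge0 u0).
  have vu : 0 < v - u by lra.
  have -> : eps * (v - s) = eps * (v - u) + eps * (u - s) by ring.
  move=> fc; have : 0 <= f (c u) * (v - u) by rewrite mulr_ge0// ltW.
  by rewrite mulrBl; lra.
Qed.

(** By monotonicity [c] stays where f vanishes, so real induction bounds its growth by any positive
    slope. *)
Lemma solution_after1 s t : 0 <= s -> s <= t -> 1 <= c s -> c t = c s.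
Proof.
move=> s0 st cs1; apply/eqP; rewrite eq_le (solution_nondecreasing s0 st) andbT.
apply/ler_addgt0Pr => e e0.
have ts0 : 0 < t - s + 1 by lra.
pose eps := e / (t - s + 1).
have eps0 : 0 < eps by exact: divr_gt0.
suff : c t <= c s + eps * (t - s).
  have : eps * (t - s + 1) = e by rewrite /eps divfK// gt_eqF.
  by nra.
apply: (@real_induction _ (fun u => c u <= c s + eps * (u - s)) s t) => //.
- by rewrite subrr mulr0 addr0.
- move=> u su ut IH; rewrite leNgt; apply/negP => lt_cs.
  have u0 : 0 < u by lra.
  have [d d0 Hd] := solution_left_lt u0 lt_cs.
  pose r := Num.max s (u - d / 2).
  have sr : s <= r by rewrite le_max lexx.
  have ru : r < u by rewrite gt_max su; lra.
  have dr : u - d / 2 <= r by rewrite le_max lexx orbT.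
  have := IH r sr ru; have := Hd r.
  have : eps * (r - s) <= eps * (u - s) by rewrite ler_pM2l//; lra.
  by lra.
- move=> u su ut IH; have u0 : 0 <= u by lra.
  have [d d0 Hd] := c_der u0 eps0; exists d => // v uv vd.
  have [||_] := Hd (v - u); [lra|lra|].
  rewrite subrKC f_after1; last by have := solution_nondecreasing s0 su; lra.
  have -> : eps * (v - s) = eps * (v - u) + eps * (u - s) by ring.
  by rewrite add0r; lra.
Qed.

Lemma solution_IVT s t z : 0 <= s -> s <= t -> c s <= z -> z <= c t ->
  exists2 r, s <= r <= t & c r = z.
Proof.
move=> s0 st csz zct.
have [c_within _ _ _] := c_sol.
have : exists2 r, r \in `[s, t] & c r = z.
  apply: IVT => //.
    apply: continuous_subspaceW c_within => x /=; rewrite !in_itv/= => /andP[]; lra.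
  have cst : c s <= c t by lra.
  by rewrite (min_idPl cst) (max_idPr cst) csz.
by move=> [r]; rewrite in_itv/= => ? ?; exists r.
Qed.

(** To exceed 1, [c] would first take the value 1, where it is stuck. *)
Lemma solution_le1 t : 0 <= t -> c t <= 1.
Proof.
move=> t0; rewrite leNgt; apply/negP => ct1.
have c01 : c 0 <= 1 by rewrite c_at0.
have [s /andP[s0 st] cs] := solution_IVT (lexx 0) t0 c01 (ltW ct1).
by have := solution_after1 s0 st; rewrite cs; lra.
Qed.

(** At time u, c grows at rate f (c u) while the integral grows at rate 1 / f (c u) in its upper
    end. The factors [1 - e] and [1 + e] absorb the errors of both comparisons, which makes real
    induction applicable. *)
Lemma inv_integral_solution_approx s t e :
  0 <= s -> s <= t -> 0 < c s -> c t < 1 -> 0 < e -> e <= 1 ->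
  (((1 - e) * (t - s))%:E <= inv_integral f (c s) (c t))%E /\
  (inv_integral f (c s) (c t) <= ((1 + e) * (t - s))%:E)%E.
Proof.
move=> s0 st cs0 ct1 e0 e1; have cs0' := ltW cs0.
apply: (@real_induction _ (fun u =>
  (((1 - e) * (u - s))%:E <= inv_integral f (c s) (c u))%E /\
  (inv_integral f (c s) (c u) <= ((1 + e) * (u - s))%:E)%E) s t) => //.
- by rewrite subrr !mulr0 inv_integral_xx.
- move=> u su ut IH; have cs_cu : c s <= c u by apply: solution_nondecreasing; lra.
  split.
    have := inv_integral_ge0 (c u) cs0'.
    case E : (inv_integral f (c s) (c u)) => [r| |]// _; last exact: leey.
    rewrite lee_fin leNgt; apply/negP => lt_r.
    (* Going back by half the gap loses at most half of it, as [1 - e <= 1]; the lower bound at [v]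
       then still exceeds [r]. *)
    pose v := Num.max s (u - ((1 - e) * (u - s) - r) / 2).
    have sv : s <= v by rewrite le_max lexx.
    have vu : v < u by rewrite gt_max su; lra.
    have [+ _] := IH v sv vu.
    have cvu : c v <= c u by apply: solution_nondecreasing; lra.
    move=> /le_trans/(_ (le_inv_integral_right cs0' cvu)); rewrite E lee_fin.
    have : u - ((1 - e) * (u - s) - r) / 2 <= v by rewrite le_max lexx orbT.
    have : 0 <= e * (u - v) by rewrite mulr_ge0//; lra.
    lra.
  move: cs_cu; rewrite le_eqVlt => /predU1P[<-|cs_cu].
    by rewrite inv_integral_xx lee_fin mulr_ge0//; lra.
  (* Any z below [c u] is exceeded by [c] shortly before [u], where the induction hypothesis
     applies. *)
  apply: inv_integral_le_left => // z csz zcu.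
  have u0 : 0 < u by lra.
  have [d d0 Hd] := solution_left_lt u0 zcu.
  pose v := Num.max s (u - d / 2).
  have sv : s <= v by rewrite le_max lexx.
  have vu : v < u by rewrite gt_max su; lra.
  have dv : u - d / 2 <= v by rewrite le_max lexx orbT.
  have zcv : z < c v by apply: Hd; lra.
  apply: le_trans (le_inv_integral_right cs0' (ltW zcv)) _.
  have [_ J2] := IH v sv vu; apply: le_trans J2 _.
  by rewrite lee_fin ler_pM2l; lra.
- move=> u su ut [IH1 IH2]; have u0 : 0 <= u by lra.
  have cs_cu : c s <= c u by exact: solution_nondecreasing.
  have cu0 : 0 < c u by lra.
  have cu1 : c u < 1 by have := solution_nondecreasing u0 (ltW ut); lra.
  have fcu := f_pos cu0 cu1.
  have fe0 : 0 < f (c u) * e by exact: mulr_gt0.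
  have fee : f (c u) * e * e <= f (c u) * e by rewrite ler_piMr// ltW.
  have fee0 : 0 < f (c u) * e * e by exact: mulr_gt0.
  have fe1 : f (c u) * e <= f (c u) by rewrite ler_piMr// ltW.
  (* For k = e f / 4 and e <= 1, both (f - k) / (f + k) >= 1 - e and
     (f + k) / (f - k) <= 1 + e. *)
  pose k := f (c u) * e / 4.
  have k0 : 0 < k by rewrite /k; lra.
  have kf : k < f (c u) by rewrite /k; lra.
  have [d d0 Hd] := inv_integral_right_bounds (ltW cu0) k0.
  have [d' d'0 Hd'] := c_der u0 k0.
  (* As [f (c u) + k <= 2 * f (c u)], this radius keeps [c v] below [c u + d]. *)
  exists (Num.min d' (d / (2 * f (c u)))).
    by rewrite lt_min d'0 divr_gt0// mulr_gt0.
  move=> v uv; rewrite -ltrBlDl lt_min => /andP[vd']; rewrite ltr_pdivlMr ?mulr_gt0// => vd.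
  have vu0 : 0 < v - u by lra.
  have := Hd' _ vu0 vd'; rewrite subrKC => -[le1 le2].
  have fkh : 0 < (f (c u) - k) * (v - u) by rewrite mulr_gt0//; lra.
  have cuv : c u < c v by lra.
  have fkh2 : (f (c u) + k) * (v - u) <= 2 * f (c u) * (v - u).
    by rewrite ler_pM2r//; lra.
  have cvd : c v < c u + d by lra.
  have [J1 /(_ kf) J2] := Hd _ cuv cvd.
  rewrite (@inv_integral_add (c s) (c u) (c v))//; last exact: ltW.
  have E a : a * (v - s) = a * (u - s) + a * (v - u) by ring.
  split; rewrite E EFinD; apply: leeD => //.
    apply: le_trans J1; rewrite lee_fin ler_pdivlMr; last lra.
    have : (1 - e) * (f (c u) + k) <= f (c u) - k by rewrite /k; lra.
    move=> /(ler_wpM2r (ltW vu0)); lra.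
  apply: le_trans J2 _; rewrite lee_fin ler_pdivrMr; last lra.
  have : f (c u) + k <= (1 + e) * (f (c u) - k) by rewrite /k; lra.
  move=> /(ler_wpM2r (ltW vu0)); lra.
Qed.

(** Let e tend to 0 in the approximate bounds; those for e = 1 already exclude infinite values. *)
Lemma inv_integral_solution s t : 0 <= s -> s <= t -> 0 < c s -> c t < 1 ->
  inv_integral f (c s) (c t) = (t - s)%:E.
Proof.
move=> s0 st cs0 ct1.
have approx e : 0 < e -> exists eps, [/\ 0 < eps, eps <= 1 & eps * (t - s) <= e].
  move=> e0; have ts0 : 0 < t - s + 1 by lra.
  exists (Num.min 1 (e / (t - s + 1))); split.
  - by rewrite lt_min ltr01 divr_gt0.
  - by rewrite ge_min lexx.
  - apply: (@le_trans _ _ (e / (t - s + 1) * (t - s))).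
      by rewrite ler_wpM2r ?subr_ge0// ge_min lexx orbT.
    have := divfK (lt0r_neq0 ts0) e; have := divr_gt0 e0 ts0; lra.
have := inv_integral_solution_approx s0 st cs0 ct1.
case: (inv_integral f (c s) (c t)) => [r| |] H; last 2 first.
- by have [_] := H _ ltr01 (lexx 1).
- by have [] := H _ ltr01 (lexx 1).
congr EFin; apply/eqP; rewrite eq_le; apply/andP; split;
  apply/ler_addgt0Pr => e /approx[eps [eps0 eps1 epse]];
  have := H _ eps0 eps1; rewrite !lee_fin => -[? ?]; lra.
Qed.

(** Take the supremum of the zeros of [c], bounded by [t1] through monotonicity; continuity makes it
    a zero. *)
Lemma solution_start t1 : 0 <= t1 -> 0 < c t1 ->
  exists a, [/\ 0 <= a, c a = 0 & forall t, a < t -> 0 < c t].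
Proof.
move=> t10 ct1; pose S := [set t : R | 0 <= t /\ c t = 0].
have S0 : S 0 by [].
have supS : has_sup S.
  split; first by exists 0.
  exists t1 => t [t0 ct]; rewrite leNgt; apply/negP => t1t.
  by have := solution_nondecreasing t10 (ltW t1t); rewrite ct; lra.
have a0 : 0 <= sup S by apply: ub_le_sup => //; case: supS.
exists (sup S); split => //.
  have := c_ge0 a0; rewrite le_eqVlt => /predU1P[//|ca].
  have a_gt0 : 0 < sup S.
    by move: a0; rewrite le_eqVlt => /predU1P[E|//]; move: ca; rewrite -E c_at0 ltxx.
  have [d d0 Hd] := solution_left_lt a_gt0 ca.
  have [s [s0 cs] ds] := sup_adherent d0 supS.
  have : s <= sup S by apply: ub_le_sup => //; case: supS.
  rewrite le_eqVlt => /predU1P[E|sa]; first by rewrite -E.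
  by have := Hd s s0 ds sa; rewrite cs ltxx.
move=> t at_; have t0 : 0 <= t by lra.
have := c_ge0 t0; rewrite le_eqVlt => /predU1P[ct|//].
have : t <= sup S by apply: ub_le_sup; [case: supS|].
lra.
Qed.

Section positive_solution.
Variable a : R.
Hypotheses (a_ge0 : 0 <= a) (c_a : c a = 0) (c_gt0 : forall t : R, a < t -> 0 < c t).

Lemma inv_integral0_solution t : a < t -> c t < 1 ->
  inv_integral f 0 (c t) = (t - a)%:E.
Proof.
move=> at_ ct1; have ct0 := c_gt0 at_; have a0 := a_ge0.
have J s : a < s -> s <= t -> inv_integral f (c s) (c t) = (t - s)%:E.
  by move=> as_ st; apply: inv_integral_solution => //; [lra|exact: c_gt0].
apply/eqP; rewrite eq_le; apply/andP; split.
  (* Continuity at [a] provides s > a with c s < z, so the integral from z is at most t - s. *)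
  apply: inv_integral_le_right => // z z0 zct.
  have [d d0 Hd] := c_cont a_ge0 z0.
  pose s := Num.min t (a + d / 2).
  have as_ : a < s by rewrite lt_min at_; lra.
  have st : s <= t by rewrite ge_min lexx.
  have sd : s <= a + d / 2 by rewrite ge_min lexx orbT.
  have : `|c s - c a| < z.
    by apply: Hd; [lra|rewrite ltr_distl; apply/andP; split; lra].
  rewrite c_a subr0 gtr0_norm ?c_gt0// => csz.
  apply: le_trans (le_inv_integral_left _ (ltW (c_gt0 as_)) (ltW csz)) _.
  by rewrite J// lee_fin; lra.
have := inv_integral_ge0 (c t) (lexx 0).
case E : (inv_integral f 0 (c t)) => [r| |]// r0; last exact: leey.
rewrite lee_fin in r0; rewrite lee_fin leNgt; apply/negP => rt.
(* From this time the elapsed time is [(t - a + r) / 2], which exceeds [r]. *)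
have as_ : a < a + (t - a - r) / 2 by lra.
have := le_inv_integral_left (c t) (lexx 0) (ltW (c_gt0 as_)).
by rewrite E J// ?lee_fin; lra.
Qed.

(** When c t < 1, the value i (c t) = t - a and the strict increase of i identify c t as c0 (t - a).
    When c t = 1, each level 1 - e was crossed at some time r <= t, so i (1 - e) = r - a <= t -
    a. *)
Lemma solution_shift t : 0 <= t -> c t = lamperti_c f (Num.max (t - a) 0).
Proof.
move=> t0; have [ta|at_] := leP t a.
  rewrite (max_idPr _) ?subr_le0// lamperti_c0.
  by apply/eqP; rewrite eq_le c_ge0// andbT -c_a solution_nondecreasing.
rewrite (max_idPl _) ?subr_ge0 ?ltW//; apply/eqP; rewrite eq_le.
have /predU1P[ct|ct1] : (c t == 1) || (c t < 1).
  by rewrite -le_eqVlt; exact: solution_le1.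
  rewrite ct lamperti_c_le1 andbT; apply/ler_addgt0Pr => e e0.
  have [e1|e1] := leP 1 e; first by have := lamperti_c_ge0 (t - a); lra.
  have [||r /andP[ar rt] cr] := @solution_IVT a t (1 - e) a_ge0 (ltW at_).
  - by rewrite c_a; lra.
  - by rewrite ct; lra.
  suff : c r <= lamperti_c f (t - a) by lra.
  apply: lamperti_c_ge; rewrite inv_integral0_solution ?lee_fin; [lra| |lra].
  by rewrite lt_neqAle ar andbT; apply/eqP => E; move: cr; rewrite -E c_a; lra.
have J := inv_integral0_solution at_ ct1.
rewrite lamperti_c_ge ?J//=; apply/ler_addgt0Pr => e e0.
have ct0 := c_ge0 t0.
apply: lamperti_c_le; first lra.
by rewrite -J; apply: inv_integral_lt; [|lra|rewrite J ltry].
Qed.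

End positive_solution.

(** A nonzero solution has values c s in (0, 1) just after its last zero a, and i (c s) = s - a is
    finite. *)
Lemma solution_eq0 t : ~ inv_integrable_at0 f -> 0 <= t -> c t = 0.
Proof.
move=> nint0 t0; have := c_ge0 t0; rewrite le_eqVlt => /predU1P[//|ct].
exfalso; have [a [a0 ca c_gt0]] := solution_start t0 ct.
have [d d0 Hd] := c_cont a0 ltr01.
have ad : a < a + d / 2 by lra.
have cd1 : c (a + d / 2) < 1.
  have : `|c (a + d / 2) - c a| < 1.
    by apply: Hd; [lra|rewrite ltr_distl; apply/andP; split; lra].
  by rewrite ca subr0; apply: le_lt_trans; exact: ler_norm.
apply: nint0; exists (c (a + d / 2)); split => //; first exact: c_gt0.
by rewrite (inv_integral0_solution a0)// ltry.
Qed.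

Lemma solution_shifted_lamperti : exists l : \bar R, (0 <= l)%E /\
  forall t, 0 <= t -> c t = shifted_lamperti_c f l t.
Proof.
have [[t [t0 ct]]|H] := pselect (exists t, 0 <= t /\ 0 < c t).
  have [a [a0 ca c_gt0]] := solution_start t0 ct.
  by exists a%:E; split; [rewrite lee_fin|exact: solution_shift].
exists +oo%E; split => // t t0 /=.
have := c_ge0 t0; rewrite le_eqVlt => /predU1P[//|ct].
by exfalso; apply: H; exists t.
Qed.

End solution.

(** * Integrability at 0 and at 1, and the behaviour of the Lamperti inverse *)

Lemma lamperti_c_eq0 t : ~ inv_integrable_at0 f -> lamperti_c f t = 0.
Proof.
move=> nint0; apply/eqP; rewrite eq_le lamperti_c_ge0 andbT.
apply/ler_addgt0Pr => e e0; rewrite add0r; apply: lamperti_c_le; first exact: ltW.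
suff -> : inv_integral f 0 e = +oo%E by exact: ltry.
apply/eqP; rewrite -leye_eq leNgt; apply/negP => fin; apply: nint0.
(* The cap provides the witness below 1 that [inv_integrable_at0] asks for. *)
exists (Num.min e 2^-1); split.
- by rewrite lt_min e0 invr_gt0 ltr0n.
- by rewrite gt_min; apply/orP; right; lra.
- by apply: le_lt_trans fin; apply: le_inv_integral_right; rewrite // ge_min lexx.
Qed.

(** Reaching 1 at time t would give i 1 <= t, hence integrability near 1. *)
Lemma lamperti_c_lt1 t : ~ inv_integrable_at1 f -> 0 <= t -> lamperti_c f t < 1.
Proof.
move=> nint1 t0; have := lamperti_c_le1 t; rewrite le_eqVlt => /predU1P[E|//].
exfalso; apply: nint1; exists 2^-1; split; [lra|lra|].
apply: (@le_lt_trans _ _ (inv_integral f 0 1)).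
  by apply: le_inv_integral_left; lra.
by rewrite -E (le_lt_trans (inv_integral_lamperti_c_le t0))// ltry.
Qed.

Lemma inv_integral_fin x : inv_locally_integrable f -> x < 1 ->
  (inv_integral f 0 x < +oo)%E.
Proof.
move=> loc x1; have [e [e0 e1 fin]] := int0.
have [xe|ex] := leP x e.
  by apply: le_lt_trans fin; exact: le_inv_integral_right.
have finex := loc _ _ e0 ex x1.
have [e0' ex'] := (ltW e0, ltW ex).
by rewrite (@inv_integral_add 0 e x)// lte_add_pinfty.
Qed.

(** c0 is at least 1 - e from time i (1 - e) on, which is finite by local integrability. *)
Lemma lamperti_c_cvg : ~ inv_integrable_at1 f -> inv_locally_integrable f ->
  lamperti_c f t @[t --> +oo] --> (1 : R).
Proof.
move=> nint1 loc; apply/cvgrPdist_le => e e0.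
have e1 : 1 - e < 1 by lra.
have := inv_integral_fin loc e1; have := inv_integral_ge0 (1 - e) (lexx 0).
case E : (inv_integral f 0 (1 - e)) => [r| |]// _ _.
near=> t; have rt : r <= t by near: t; apply: nbhs_pinfty_ge; exact: num_real.
have : 1 - e <= lamperti_c f t by apply: lamperti_c_ge; rewrite E lee_fin.
have := lamperti_c_le1 t.
by rewrite ler_distl => *; apply/andP; split; lra.
Unshelve. all: by end_near. Qed.

(** The hitting time is i 1, finite by splitting the integral at 1 - e; hitting 1 at an earlier time
    t would give i 1 <= t. *)
Lemma lamperti_c_hit1 : inv_integrable_at1 f -> inv_locally_integrable f ->
  exists T : R, [/\ inv_integral f 0 1 = T%:E, lamperti_c f T = 1 &
    forall t, 0 <= t -> t < T -> lamperti_c f t < 1].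
Proof.
move=> [e [e0 e1 fin1]] loc.
have fin : (inv_integral f 0 1 < +oo)%E.
  have [e1' e1''] : 0 <= 1 - e /\ 1 - e <= 1 by split; lra.
  rewrite (@inv_integral_add 0 (1 - e) 1)// lte_add_pinfty//.
  by apply: inv_integral_fin => //; lra.
have := inv_integral_ge0 1 (lexx 0); move: fin.
case E : (inv_integral f 0 1) => [T| |]// _ _; exists T; split => //.
  by apply/eqP; rewrite eq_le lamperti_c_le1 lamperti_c_ge// E.
move=> t t0 tT; have := lamperti_c_le1 t; rewrite le_eqVlt => /predU1P[ct|//].
by have := inv_integral_lamperti_c_le t0; rewrite ct E lee_fin; lra.
Qed.

End inv_integral_theory.

Theorem proposition2 (R : realType) (f : R -> R)
  (f_ge0 : forall t, 0 <= t -> 0 <= f t)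
  (f_cadlag : cadlag f)
  (f_jump : forall t, 0 < t -> 0 <= jump f t)
  (f_at0 : f 0 = 0)
  (f_after1 : forall t, 1 <= t -> f t = 0)
  (f_pos : forall t, 0 < t -> t < 1 -> 0 < f t) :
  (~ inv_integrable_at0 f ->
    [/\ forall t, 0 <= t -> lamperti_h f t = 0 /\ lamperti_c f t = 0,
        is_solution f (fun=> 0) &
        forall c, is_solution f c -> forall t, 0 <= t -> c t = 0])
  /\
  (inv_integrable_at0 f ->
    [/\ exists t, 0 <= t /\ lamperti_c f t <> 0,
        forall t, 0 <= t ->
          is_right_derive (lamperti_c f) t (lamperti_h f t),
        is_solution f (lamperti_c f) &
        forall c, is_solution f c <->
          exists lambda : \bar R, (0 <= lambda)%E /\
            forall t, 0 <= t -> c t = shifted_lamperti_c f lambda t]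
    /\
    (~ inv_integrable_at1 f ->
      (forall s t, 0 <= s -> s < t -> lamperti_c f s < lamperti_c f t) /\
      (inv_locally_integrable f ->
        lamperti_c f t @[t --> +oo] --> (1 : R)))
    /\
    (inv_integrable_at1 f ->
      (forall s t, 0 <= s -> s < t -> lamperti_c f s < 1 ->
        lamperti_c f s < lamperti_c f t) /\
      (inv_locally_integrable f ->
        exists T : R, [/\ inv_integral f 0 1 = T%:E,
          lamperti_c f T = 1 &
          forall t, 0 <= t -> t < T -> lamperti_c f t < 1]))).
Proof.
split=> [nint0|int0].
  have c_eq0 t := lamperti_c_eq0 f_ge0 f_cadlag f_jump f_after1 t nint0.
  split.
  - by move=> t _; rewrite /lamperti_h/= c_eq0.
  - exact: zero_solution.
  - by move=> c c_sol t t0; exact: (solution_eq0 f_ge0 f_cadlag f_jump f_pos c_sol).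
have c_lt s t : 0 <= s -> s < t -> lamperti_c f s < 1 ->
    lamperti_c f s < lamperti_c f t.
  exact: lamperti_c_lt.
have c_sol : is_solution f (lamperti_c f) by exact: lamperti_c_solution.
split; [split|split] => //.
- exact: lamperti_c_neq0.
- by case: c_sol.
- move=> c; split=> [c_is_sol|[[l| |] [l0 cE]]].
  + exact: solution_shifted_lamperti.
  + apply: (is_solution_ext cE); apply: shifted_solution => //.
  + by apply: (is_solution_ext cE); exact: zero_solution.
  + by [].
- move=> nint1; split; last exact: lamperti_c_cvg.
  by move=> s t s0 st; apply: c_lt => //; exact: lamperti_c_lt1.
- by move=> int1; split => //; exact: lamperti_c_hit1.
Qed.
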